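(* Let $K$ be an arbitrary (possibly infinite) index set and let $\mathcal{M} = (M_i \colon i \in K)$ be a family of matroids on a common ground set $E$ (possibly infinite), each of which is either finitary or cofinitary. Then $\mathcal{M}$ admits a base partitioning if and only if it admits both a base covering and a base packing.
   Context: Matroids here are possibly infinite: a matroid is a pair $(E,\mathcal{I})$ with $\mathcal{I}\subseteq\mathcal{P}(E)$ such that (1) $\emptyset\in\mathcal{I}$; (2) $\mathcal{I}$ is closed under subsets; (3) for all $I,B\in\mathcal{I}$ with $B$ maximal in $\mathcal{I}$ and $I$ not maximal, there is $x\in B\setminus I$ with $I\cup\{x\}\in\mathcal{I}$; (4) for every $X\subseteq E$, every $I\in\mathcal{I}$ with $I\subseteq X$ extends to a maximal element of $\mathcal{I}\cap\mathcal{P}(X)$. Independent sets are members of $\mathcal{I}$, bases are maximal independent sets, circuits are minimal dependent sets. The dual $M^*$ is the matroid on $E$ whose bases are the complements of the bases of $M$. $M$ is finitary if all its circuits are finite, and cofinitary if $M^*$ is finitary. For a family $(M_i\colon i\in K)$ on $E$, a family $(B_i\colon i\in K)$ with each $B_i$ a base of $M_i$ is a base covering if $\bigcup_i B_i=E$, a base packing if the $B_i$ are pairwise disjoint, and a base partitioning if $(B_i\colon i\in K)$ is a partition of $E$ (pairwise disjoint with union $E$). *)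

(* Defs.v *)
(* Sets over a ground type E are predicates E -> Prop;
   the ground set of all matroids is the whole type E. *)
From Stdlib Require Import List.

Section MatroidDefs.
Variable E : Type.

Definition subset (X Y : E -> Prop) : Prop := forall x, X x -> Y x.

Definition maximal (F : (E -> Prop) -> Prop) (X : E -> Prop) : Prop :=
  F X /\ forall Y, F Y -> subset X Y -> subset Y X.

Definition add1 (X : E -> Prop) (x : E) : E -> Prop := fun y => X y \/ y = x.

Definition is_matroid (I : (E -> Prop) -> Prop) : Prop :=
  (* (I1) *) I (fun _ => False) /\
  (* (I2) *) (forall A B, I B -> subset A B -> I A) /\
  (* (I3) *) (forall A B, I A -> ~ maximal I A -> maximal I B ->
                exists x, B x /\ ~ A x /\ I (add1 A x)) /\
  (* (IM) *) (forall X A, I A -> subset A X ->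
                exists B, subset A B /\
                  maximal (fun Y => I Y /\ subset Y X) B).

Definition base (I : (E -> Prop) -> Prop) (B : E -> Prop) : Prop := maximal I B.

Definition circuit (I : (E -> Prop) -> Prop) (C : E -> Prop) : Prop :=
  ~ I C /\ forall D, subset D C -> ~ I D -> subset C D.

Definition finite_set (X : E -> Prop) : Prop :=
  exists l : list E, forall x, X x -> In x l.

Definition finitary (I : (E -> Prop) -> Prop) : Prop :=
  forall C, circuit I C -> finite_set C.

(* The dual matroid: its bases are the complements of the bases of M,
   so its independent sets are the subsets of complements of bases of M. *)
Definition dual (I : (E -> Prop) -> Prop) : (E -> Prop) -> Prop :=
  fun X => exists B, base I B /\ forall x, X x -> ~ B x.

Definition cofinitary (I : (E -> Prop) -> Prop) : Prop := finitary (dual I).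

End MatroidDefs.

Section Families.
Variables (K E : Type).

Definition base_covering (M : K -> (E -> Prop) -> Prop) (B : K -> E -> Prop) : Prop :=
  (forall i, base E (M i) (B i)) /\ (forall x, exists i, B i x).

Definition base_packing (M : K -> (E -> Prop) -> Prop) (B : K -> E -> Prop) : Prop :=
  (forall i, base E (M i) (B i)) /\ (forall i j x, B i x -> B j x -> i = j).

Definition base_partitioning (M : K -> (E -> Prop) -> Prop) (B : K -> E -> Prop) : Prop :=
  (forall i, base E (M i) (B i)) /\ (forall x, exists i, B i x) /\
  (forall i j x, B i x -> B j x -> i = j).

End Families.

(* Main.v *)
(* Fleiner's matroid-kernel argument (generalised stable matchings).  Fix a base
   packing P and, choosing for each x one base of the covering that contains it,
   disjoint independent sets C i that cover E.  In M i prefer the elements of C i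
   to the others, and rank the others by a well-order if M i is finitary and by
   a reversed well-order if M i is cofinitary: then in every set the greedily
   accepted elements form a maximal independent subset, and the set of rejected
   elements is monotone.  Dually, let each x prefer the index i with P i x to
   the index i with C i x.  Knaster-Tarski yields a stable family S.  No element of C i
   is ever rejected by M i, so S covers E; no x rejects its index in P, so
   every S i spans the base P i. *)

From mathcomp Require ssrbool.
From mathcomp Require Import eqtype boolp wochoice.
From Stdlib Require Import Classical ClassicalEpsilon List.
Require Import Defs.

(** * Well-orders and finite maxima *)

Lemma exists_well_order (E : Type) : exists lt : E -> E -> Prop,
  (forall x, ~ lt x x) /\
  (forall x y z, lt x y -> lt y z -> lt x z) /\
  (forall P : E -> Prop, (exists x, P x) ->
     exists m, P m /\ forall y, P y -> y = m \/ lt m y).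
Proof.
destruct (wochoice.well_ordering_principle (classicType E)) as [R HR].
assert (Hmin : forall P : E -> Prop, (exists x, P x) ->
          exists m, (P m /\ forall y, P y -> R m y = true) /\
            forall m', P m' /\ (forall y, P y -> R m' y = true) -> m = m').
{ intros P [x Px].
  destruct (HR (fun y => asbool (P y))) as [m [[Pm Hm] Huniq]].
  - exists x. apply (ssrbool.introT (asboolP _)). exact Px.
  - exists m. split; [split|].
    + exact (ssrbool.elimT (asboolP _) Pm).
    + intros y Py. apply Hm. apply (ssrbool.introT (asboolP _)). exact Py.
    + intros m' [Pm' Hm']. apply Huniq. split.
      * apply (ssrbool.introT (asboolP _)). exact Pm'.
      * intros y Py. apply Hm'. exact (ssrbool.elimT (asboolP _) Py). }
(* Unique minima of one-, two- and three-element sets make [R] a linear order. *)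
assert (Hrefl : forall x, R x x = true).
{ intros x. destruct (Hmin (fun y => y = x)) as [m [[-> Hm] _]]; eauto. }
assert (Hanti : forall x y, R x y = true -> R y x = true -> x = y).
{ intros x y Rxy Ryx.
  destruct (Hmin (fun w => w = x \/ w = y)) as [m [_ Huniq]]; [eauto|].
  transitivity m; [symmetry|]; apply Huniq; (split; [auto|]); intros w [->| ->]; auto. }
assert (Htrans : forall x y z, R x y = true -> R y z = true -> R x z = true).
{ intros x y z Rxy Ryz.
  destruct (Hmin (fun w => w = x \/ w = y \/ w = z)) as [m [[Hm Hle] _]]; [eauto|].
  destruct Hm as [->|[->| ->]].
  - apply Hle; auto.
  - rewrite (Hanti x y); auto.
  - rewrite (Hanti y z) in Rxy; auto. }
exists (fun x y => R x y = true /\ x <> y). split; [|split].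
- intros x [_ Hx]. auto.
- intros x y z [Rxy nxy] [Ryz nyz]. split; [eauto|].
  intros ->. apply nxy. auto.
- intros P HP. destruct (Hmin P HP) as [m [[Pm Hm] _]]. exists m. split; [exact Pm|].
  intros y Py. destruct (classic (y = m)) as [|n]; [auto|right; auto].
Qed.

Lemma finite_set_max (E : Type) (lt : E -> E -> Prop)
  (Htrans : forall x y z, lt x y -> lt y z -> lt x z)
  (Htotal : forall x y, x = y \/ lt x y \/ lt y x)
  (P : E -> Prop) :
  finite_set E P -> (exists x, P x) ->
  exists m, P m /\ forall y, P y -> y = m \/ lt y m.
Proof.
intros [l Hl]. revert P Hl. induction l as [|a l IH]; intros P Hl [x Px].
- destruct (Hl x Px).
- destruct (classic (exists y, P y /\ y <> a)) as [Hy|Hn].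
  + destruct (IH (fun y => P y /\ y <> a)) as [m [[Pm nm] Hm]].
    * intros y [Py ny]. destruct (Hl y Py); [congruence|assumption].
    * exact Hy.
    * destruct (classic (P a /\ lt m a)) as [[Pa ltma]|Hn].
      -- exists a. split; [exact Pa|]. intros y Py.
         destruct (classic (y = a)) as [|n]; [auto|right].
         destruct (Hm y (conj Py n)) as [->|]; eauto.
      -- exists m. split; [exact Pm|]. intros y Py.
         destruct (classic (y = a)) as [->|n]; [|apply Hm; auto].
         destruct (Htotal a m) as [|[|]]; tauto.
  + assert (Ha : forall y, P y -> y = a).
    { intros y Py. apply NNPP. intros n. apply Hn. eauto. }
    exists x. split; [exact Px|]. intros y Py. left.
    rewrite (Ha y Py), (Ha x Px). reflexivity.
Qed.

(** * Exchange, closure and circuits *)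

(** If no element of [B] extends [A], then swapping [y] into a base that completes [A] from outside
    [X] drops an element of a base containing [B], which leaves room to enlarge [B] within [X]. *)
Lemma restricted_exchange (E : Type) (I : (E -> Prop) -> Prop) (X A B : E -> Prop) (y : E) :
  is_matroid E I -> subset E A X ->
  maximal E (fun Y => I Y /\ subset E Y X) B ->
  X y -> ~ A y -> I (add1 E A y) ->
  exists x, B x /\ ~ A x /\ I (add1 E A x).
Proof.
intros [_ [Hsub [Hex Hext]]] HAX [[IB HBX] HBmax] Xy nAy IAy.
apply NNPP. intros Hno.
assert (IA : I A) by (apply (Hsub _ _ IAy); intros z; unfold add1; auto).
destruct (Hext (fun _ => True) B IB (fun _ _ => Logic.I)) as [Bh [HBBh [[IBh _] HBhmax']]].
assert (HBh : maximal E I Bh).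
{ split; [exact IBh|]. intros Y IY HY. apply HBhmax'; [|exact HY].
  split; [exact IY|intros z _; exact Logic.I]. }
clear HBhmax'.
assert (HBhX : forall z, Bh z -> X z -> B z).
{ intros z Bz Xz. apply (HBmax (add1 E B z)).
  - split.
    + apply (Hsub _ Bh IBh). intros w [Hw| ->]; auto.
    + intros w [Hw| ->]; auto.
  - intros w Hw; left; exact Hw.
  - right; reflexivity. }
(* As nothing in [B] extends [A], elements of [Bh] outside [B] suffice to complete [A] to a base. *)
destruct (Hext (fun z => A z \/ (Bh z /\ ~ B z)) A IA (fun z Az => or_introl Az))
  as [J [HAJ [[IJ HJ] HJmax]]].
assert (HJbase : maximal E I J).
{ apply NNPP. intros nJ. destruct (Hex J Bh IJ nJ HBh) as [x [Bhx [nJx IJx]]].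
  destruct (classic (B x)) as [Bx|nBx].
  - apply Hno. exists x. split; [exact Bx|split; [auto|]].
    apply (Hsub _ _ IJx). intros w [Hw| ->]; [left; auto|right; reflexivity].
  - apply nJx. apply (HJmax (add1 E J x)).
    + split; [exact IJx|]. intros w [Hw| ->]; auto.
    + intros w Hw; left; exact Hw.
    + right; reflexivity. }
assert (nJy : ~ J y).
{ intros Jy. destruct (HJ y Jy) as [|[Bhy nBy]]; auto. }
destruct (Hext (add1 E J y) (add1 E A y) IAy) as [J' [HAJ' [[IJ' HJ'] HJ'max]]].
{ intros w [Hw| ->]; [left; auto|right; reflexivity]. }
assert (HJ'base : maximal E I J').
{ apply NNPP. intros nJ'. destruct (Hex J' J IJ' nJ' HJbase) as [x [Jx [nJ'x IJ'x]]].
  apply nJ'x. apply (HJ'max (add1 E J' x)).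
  - split; [exact IJ'x|]. intros w [Hw| ->]; [auto|left; exact Jx].
  - intros w Hw; left; exact Hw.
  - right; reflexivity. }
assert (Hz : exists z, J z /\ ~ J' z).
{ apply NNPP. intros Hn. apply nJy. apply (proj2 HJbase J' IJ').
  - intros w Jw. apply NNPP. intros nw. apply Hn. eauto.
  - apply HAJ'. right; reflexivity. }
destruct Hz as [z [Jz nJ'z]].
assert (Bhz : Bh z /\ ~ B z).
{ destruct (HJ z Jz) as [Az|]; [|assumption]. destruct nJ'z. apply HAJ'. left; exact Az. }
(* B together with W := J' \ (A + y) misses z, so it is not a base and grows by
   some x in J', which then lies in A + y, contradicting the maximality of B. *)
set (BW := fun w => B w \/ (J' w /\ ~ add1 E A y w)).
assert (HBW : subset E BW Bh).
{ intros w [Hw|[Hw nw]]; [auto|].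
  destruct (HJ' w Hw) as [Jw| ->]; [|destruct nw; right; reflexivity].
  destruct (HJ w Jw) as [Aw|[Bhw _]]; [destruct nw; left; exact Aw|exact Bhw]. }
assert (IBW : I BW) by (apply (Hsub _ _ IBh HBW)).
assert (nBW : ~ maximal E I BW).
{ intros [_ Hm]. destruct (Hm Bh IBh HBW z (proj1 Bhz)) as [|[]]; tauto. }
destruct (Hex BW J' IBW nBW HJ'base) as [x [J'x [nBWx IBWx]]].
assert (HAx : add1 E A y x) by (apply NNPP; intros n; apply nBWx; right; auto).
apply nBWx. left. apply (HBmax (add1 E B x)).
- split.
  + apply (Hsub _ _ IBWx). intros w [Hw| ->]; [left; left; exact Hw|right; reflexivity].
  + intros w [Hw| ->]; [auto|]. destruct HAx as [Ax| ->]; auto.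
- intros w Hw; left; exact Hw.
- right; reflexivity.
Qed.

(* Transitivity of the closure operator. *)
Lemma dependent_add1_trans (E : Type) (I : (E -> Prop) -> Prop) (A J : E -> Prop) (x : E) :
  is_matroid E I -> I J ->
  (forall y, J y -> A y \/ ~ I (add1 E A y)) ->
  ~ I (add1 E J x) -> A x \/ ~ I (add1 E A x).
Proof.
intros HI IJ HJ nJx. apply NNPP. intros Hn.
apply not_or_and in Hn. destruct Hn as [nAx IAx]. apply NNPP in IAx.
set (Z := fun z => A z \/ ~ I (add1 E A z)).
pose proof HI as [_ [Hsub [_ Hext]]].
destruct (Hext Z J IJ HJ) as [J' [HJJ' [[IJ' HJ'] HJ'max]]].
assert (nJ'x : ~ I (add1 E J' x)).
{ intros H. apply nJx. apply (Hsub _ _ H). intros w [Hw| ->]; [left; auto|right; reflexivity]. }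
(* [J'] stays maximal independent once [x] joins [Z], so exchange would extend [A] by an element of
   its closure [Z]. *)
destruct (restricted_exchange E I (add1 E Z x) A J' x) as [y [J'y [nAy IAy]]]; auto.
- intros w Hw. left; left; exact Hw.
- split.
  + split; [exact IJ'|]. intros w Hw. left; auto.
  + intros Y [IY HY] HJ'Y. apply HJ'max; [|exact HJ'Y]. split; [exact IY|].
    intros w Yw. destruct (HY w Yw) as [|Hwx]; [assumption|].
    destruct nJ'x. apply (Hsub _ _ IY). intros v [Hv| ->]; [auto|].
    rewrite <- Hwx. exact Yw.
- right; reflexivity.
- destruct (HJ' y J'y); auto.
Qed.

(** Infinite dependent sets allow no step-by-step shrinking; instead take the fundamental circuit of
    an element outside a maximal independent subset. *)
Lemma dependent_contains_circuit (E : Type) (I : (E -> Prop) -> Prop) (A : E -> Prop) :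
  is_matroid E I -> ~ I A -> exists D, subset E D A /\ circuit E I D.
Proof.
intros HI nA. pose proof HI as [I0 [Hsub [_ Hext]]].
destruct (Hext A (fun _ => False) I0) as [J [_ [[IJ HJA] HJmax]]].
{ intros z []. }
assert (Hx : exists x, A x /\ ~ J x).
{ apply NNPP. intros Hn. apply nA. apply (Hsub _ _ IJ). intros w Aw.
  apply NNPP. intros nw. apply Hn. eauto. }
destruct Hx as [x [Ax nJx]].
assert (nIJx : ~ I (add1 E J x)).
{ intros H. apply nJx. apply (HJmax (add1 E J x)).
  - split; [exact H|]. intros w [Hw| ->]; auto.
  - intros w Hw; left; exact Hw.
  - right; reflexivity. }
set (Jx := add1 E J x) in *.
(* Removing any one of these elements makes [Jx] independent, so every dependent subset of [Jx]
   contains them all. *)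
set (D := fun y => Jx y /\ I (fun z => Jx z /\ z <> y)).
exists D. split; [|split].
- intros w [[Hw| ->] _]; auto.
- intros ID. destruct (Hext Jx D ID (fun w Hw => proj1 Hw)) as [B [HDB [HB HBmax]]].
  destruct HB as [IB HBJ].
  assert (Hz : exists z, Jx z /\ ~ B z).
  { apply NNPP. intros Hn. apply nIJx. apply (Hsub _ _ IB). intros w Hw.
    apply NNPP. intros nw. apply Hn. eauto. }
  destruct Hz as [z [Jxz nBz]].
  assert (zx : z <> x).
  { intros ->. apply nBz. apply HDB. split; [exact Jxz|].
    apply (Hsub _ _ IJ). intros w [[Hw| ->] n]; [exact Hw|congruence]. }
  assert (Jz : J z) by (destruct Jxz; [assumption|contradiction]).
  (* Exchange from [B] into [J] minus [z] can only add [x], which puts [z] in [D]. *)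
  destruct (restricted_exchange E I Jx (fun w => J w /\ w <> z) B z) as [y [By [nJy IJy]]]; auto.
  + intros w [Hw _]. left; exact Hw.
  + split; [split|]; auto.
  + intros [_ n]; auto.
  + apply (Hsub _ _ IJ). intros w [[Hw _]| ->]; auto.
  + apply nBz. apply HDB. split; [exact Jxz|]. apply (Hsub _ _ IJy).
    assert (yx : y = x).
    { destruct (HBJ y By) as [Jy|]; [|assumption].
      destruct nJy. split; [exact Jy|]. intros ->. auto. }
    subst y. intros w [[Hw| ->] n]; [left; auto|right; reflexivity].
- intros D' HD' nID' y Dy. apply NNPP. intros nD'y. apply nID'.
  apply (Hsub _ _ (proj2 Dy)). intros w Hw. split.
  + exact (proj1 (HD' w Hw)).
  + intros ->. auto.
Qed.

(** * Greedy selection in one matroid *)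

(* x lies in the closure of the elements of X preferred to it; [before] ranks
   the elements outside C, all of which come after those of C. *)
Definition rejected (E : Type) (I : (E -> Prop) -> Prop) (C : E -> Prop)
  (before : E -> E -> Prop) (X : E -> Prop) (x : E) : Prop :=
  ~ C x /\ exists J, (forall y, J y -> X y /\ (C y \/ before y x)) /\
                     I J /\ ~ I (add1 E J x).

Definition accepted (E : Type) (I : (E -> Prop) -> Prop) (C : E -> Prop)
  (before : E -> E -> Prop) (X : E -> Prop) (x : E) : Prop :=
  X x /\ ~ rejected E I C before X x.

(** In a circuit of accepted elements, the last element [m] outside [C] is spanned by the others,
    all preferred to [m], so it would be rejected. *)
Lemma accepted_independent (E : Type) (I : (E -> Prop) -> Prop) (C : E -> Prop)
  (before : E -> E -> Prop) (X : E -> Prop) :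
  is_matroid E I -> I C ->
  (forall D, circuit E I D -> (exists x, D x /\ ~ C x) ->
     exists m, (D m /\ ~ C m) /\ forall y, D y /\ ~ C y -> y = m \/ before y m) ->
  I (accepted E I C before X).
Proof.
intros HI IC Hmax. apply NNPP. intros nA. pose proof HI as [_ [Hsub _]].
destruct (dependent_contains_circuit _ _ _ HI nA) as [D [HDA HD]].
assert (Hx : exists x, D x /\ ~ C x).
{ apply NNPP. intros Hn. apply (proj1 HD). apply (Hsub _ _ IC). intros w Dw.
  apply NNPP. intros nw. apply Hn. eauto. }
destruct (Hmax D HD Hx) as [m [[Dm nCm] Hm]].
apply (proj2 (HDA m Dm)). split; [exact nCm|].
exists (fun w => D w /\ w <> m). split; [|split].
- intros y [Dy ny]. split; [exact (proj1 (HDA y Dy))|].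
  destruct (classic (C y)) as [|nC]; [auto|right].
  destruct (Hm y (conj Dy nC)); [contradiction|assumption].
- apply NNPP. intros n. apply (proj2 HD _) in n; [destruct (n m Dm) as [_ H]; auto|].
  intros w [Hw _]; exact Hw.
- intros H. apply (proj1 HD). apply (Hsub _ _ H). intros w Dw.
  destruct (classic (w = m)) as [->|n]; [right; reflexivity|left; auto].
Qed.

(** A least unspanned element is rejected because of elements of [C] or earlier ones; all of these
    are spanned, hence so is it. *)
Lemma accepted_spans_well_order (E : Type) (I : (E -> Prop) -> Prop) (C : E -> Prop)
  (lt : E -> E -> Prop) (X : E -> Prop) :
  is_matroid E I ->
  (forall x, ~ lt x x) ->
  (forall x y z, lt x y -> lt y z -> lt x z) ->
  (forall P : E -> Prop, (exists x, P x) ->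
     exists m, P m /\ forall y, P y -> y = m \/ lt m y) ->
  let A := accepted E I C lt X in
  forall x, X x -> A x \/ ~ I (add1 E A x).
Proof.
intros HI Hirr Htr Hmin A.
apply NNPP. intros Hn. apply not_all_ex_not in Hn.
destruct (Hmin (fun x => ~ (X x -> A x \/ ~ I (add1 E A x))) Hn) as [m [Hm Hle]].
apply Hm. intros Xm. destruct (classic (A m)) as [|nAm]; [auto|].
assert (Hrej : rejected E I C lt X m) by (apply NNPP; intros n; apply nAm; split; auto).
destruct Hrej as [_ [J [HJ [IJ nJm]]]].
apply (dependent_add1_trans E I A J m); auto.
intros y Jy. destruct (HJ y Jy) as [Xy [Cy|ltym]].
- left. split; [exact Xy|]. intros [nC _]; auto.
- apply NNPP. intros Hy.
  destruct (Hle y) as [->|ltmy]; [auto|exact (Hirr _ ltym)|exact (Hirr _ (Htr _ _ _ ltym ltmy))].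
Qed.

(** This set is the complement of the closure of [B']. Every base meets it, since any base can
    extend [B']; it is minimal, since [B'] plus any [z] of it is a base meeting it only in [z]. *)
Lemma fundamental_cocircuit (E : Type) (I : (E -> Prop) -> Prop) (B : E -> Prop) (x : E) :
  is_matroid E I -> base E I B -> B x ->
  let B' := fun w => B w /\ w <> x in
  circuit E (dual E I) (fun z => ~ B' z /\ I (add1 E B' z)).
Proof.
intros [_ [Hsub [Hex _]]] HB Bx B'.
assert (IB' : I B') by (apply (Hsub _ _ (proj1 HB)); intros w [Hw _]; exact Hw).
split.
- intros [B2 [HB2 Hdisj]].
  destruct (Hex B' B2 IB') as [z [B2z [nz Iz]]]; auto.
  + intros [_ Hm]. destruct (Hm B (proj1 HB)) with (x := x) as [_ n]; auto.
    intros w [Hw _]; exact Hw.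
  + apply (Hdisj z); auto.
- intros D HD nD z [nz Iz]. apply NNPP. intros nDz. apply nD.
  exists (add1 E B' z). split.
  + apply NNPP. intros nmax.
    destruct (Hex _ _ Iz nmax HB) as [b [Bb [nb Ib]]].
    assert (bx : b = x).
    { apply NNPP. intros n. apply nb. left; split; auto. }
    subst b. apply nb. right. apply NNPP. intros zx. apply nz. split; [|auto].
    apply (proj2 HB (add1 E B z)).
    * apply (Hsub _ _ Ib). intros w [Hw| ->]; [|left; right; reflexivity].
      destruct (classic (w = x)) as [->|]; [right; reflexivity|left; left; split; auto].
    * intros w Hw; left; exact Hw.
    * right; reflexivity.
  + intros w Dw [Hw| ->]; [|auto]. apply (proj1 (HD w Dw)). exact Hw.
Qed.

(* Every element d of the fundamental cocircuit D of a bad element x would be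
   outside the closure of the complement of D, so the first element of D in X
   would be accepted, although the accepted elements avoid D. *)
Lemma accepted_spans_cofinitary (E : Type) (I : (E -> Prop) -> Prop) (C : E -> Prop)
  (before : E -> E -> Prop) (X : E -> Prop) :
  is_matroid E I ->
  (forall D, circuit E (dual E I) D -> (exists x, D x /\ X x) ->
     exists m, (D m /\ X m) /\ forall y, D y /\ X y -> ~ before y m) ->
  let A := accepted E I C before X in
  forall x, X x -> A x \/ ~ I (add1 E A x).
Proof.
intros HI Hmin A x Xx. apply NNPP. intros Hn.
apply not_or_and in Hn. destruct Hn as [nAx IAx]. apply NNPP in IAx.
pose proof HI as [_ [Hsub [_ Hext]]].
destruct (Hext (fun _ => True) _ IAx (fun _ _ => Logic.I)) as [B [HAB [[IB _] HBmax]]].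
assert (HB : base E I B).
{ split; [exact IB|]. intros Y IY HY. apply HBmax; [|exact HY].
  split; [exact IY|intros z _; exact Logic.I]. }
assert (Bx : B x) by (apply HAB; right; reflexivity).
pose proof (fundamental_cocircuit E I B x HI HB Bx) as HD. cbv zeta in HD.
set (B' := fun w => B w /\ w <> x) in *.
set (D := fun z => ~ B' z /\ I (add1 E B' z)) in *.
assert (HAD : forall y, A y -> ~ D y).
{ intros y Ay [n _]. apply n. split; [apply HAB; left; exact Ay|]. intros ->. auto. }
destruct (Hmin D HD) as [d [[Dd Xd] Hd]].
{ exists x. split; [|exact Xx]. split.
  - intros [_ n]; auto.
  - apply (Hsub _ _ IB). intros w [[Hw _]| ->]; auto. }
assert (Hrej : rejected E I C before X d).
{ apply NNPP. intros n. apply (HAD d); [split; auto|exact Dd]. }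
destruct Hrej as [_ [J [HJ [IJ nJd]]]].
destruct (dependent_add1_trans E I B' J d) as [H|H]; auto.
- intros y Jy. apply NNPP. intros Hn. apply not_or_and in Hn.
  destruct Hn as [nB'y Iy]. apply NNPP in Iy.
  assert (Dy : D y) by (split; auto).
  destruct (HJ y Jy) as [Xy [Cy|b]].
  + apply (HAD y); [|exact Dy]. split; [exact Xy|]. intros [nC _]; auto.
  + apply (Hd y); auto.
- exact (proj1 Dd H).
- exact (H (proj2 Dd)).
Qed.

(** Independence needs last elements in circuits, spanning needs first ones. A well-order leaves
    only the former to finite circuits; its reverse leaves only the latter to finite cocircuits. *)
Lemma exists_greedy_order (E : Type) (I : (E -> Prop) -> Prop) (C : E -> Prop) :
  is_matroid E I -> finitary E I \/ cofinitary E I -> I C ->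
  exists before : E -> E -> Prop, forall X,
    let A := accepted E I C before X in
    I A /\ forall x, X x -> A x \/ ~ I (add1 E A x).
Proof.
intros HI Hfin IC.
destruct (exists_well_order E) as [lt [Hirr [Htr Hmin]]].
assert (Htot : forall x y, x = y \/ lt x y \/ lt y x).
{ intros x y. destruct (Hmin (fun z => z = x \/ z = y)) as [m [Hm Hle]]; [eauto|].
  destruct Hm as [->| ->].
  - destruct (Hle y); auto.
  - destruct (Hle x); auto. }
assert (Hmax : forall D P : E -> Prop, finite_set E D -> (exists x, D x /\ P x) ->
          exists m, (D m /\ P m) /\ forall y, D y /\ P y -> y = m \/ lt y m).
{ intros D P [l Hl]. apply (finite_set_max E lt Htr Htot (fun y => D y /\ P y)).
  exists l. intros y [Dy _]; auto. }
destruct Hfin as [Hf|Hc].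
- exists lt. intros X A. split.
  + apply accepted_independent; auto.
  + apply accepted_spans_well_order; auto.
- exists (fun y x => lt x y). intros X A. split.
  + apply accepted_independent; auto.
  + apply accepted_spans_cofinitary; auto. intros D HD Hx.
    destruct (Hmax D X (Hc D HD) Hx) as [m [Hm Hle]].
    exists m. split; [exact Hm|]. intros y Hy ltmy.
    destruct (Hle y Hy) as [->|ltym]; [exact (Hirr _ ltmy)|exact (Hirr _ (Htr _ _ _ ltym ltmy))].
Qed.

(** * Fixed point and stable family *)

Lemma knaster_tarski (T : Type) (Phi : (T -> Prop) -> T -> Prop) :
  (forall X Y : T -> Prop, (forall t, X t -> Y t) -> forall t, Phi X t -> Phi Y t) ->
  exists X, forall t, X t <-> Phi X t.
Proof.
intros Hmono. set (X := fun t => exists Z, (forall s, Z s -> Phi Z s) /\ Z t).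
assert (Hpost : forall t, X t -> Phi X t).
{ intros t [Z [HZ Zt]]. apply (Hmono Z X); [|auto]. intros s Zs. exists Z; auto. }
exists X. intros t. split; [apply Hpost|].
intros HPhi. exists (Phi X). split; [|exact HPhi]. apply Hmono. exact Hpost.
Qed.

Theorem theorem1p2 (K E : Type) (M : K -> (E -> Prop) -> Prop)
  (HM : forall i, is_matroid E (M i))
  (Hfin : forall i, finitary E (M i) \/ cofinitary E (M i)) :
  (exists B, base_partitioning K E M B) <->
  ((exists B, base_covering K E M B) /\ (exists B, base_packing K E M B)).
Proof.
split.
{ intros [B [HB [Hcov Hdis]]]. split; exists B; split; auto. }
intros [[Q [HQ Hcov]] [P [HP Hpack]]].
set (c := fun x => proj1_sig (constructive_indefinite_description _ (Hcov x))).
assert (Hc : forall x, Q (c x) x)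
  by (intros x; exact (proj2_sig (constructive_indefinite_description _ (Hcov x)))).
set (C := fun i x => c x = i).
assert (IC : forall i, M i (C i)).
{ intros i. apply (proj1 (proj2 (HM i)) _ _ (proj1 (HQ i))). intros x <-. apply Hc. }
set (before := fun i => proj1_sig (constructive_indefinite_description _
                  (exists_greedy_order E (M i) (C i) (HM i) (Hfin i) (IC i)))).
assert (Hbefore : forall i X, let A := accepted E (M i) (C i) (before i) X in
          M i A /\ forall x, X x -> A x \/ ~ M i (add1 E A x))
  by (intros i; exact (proj2_sig (constructive_indefinite_description _
                  (exists_greedy_order E (M i) (C i) (HM i) (Hfin i) (IC i))))).
set (rej := fun i => rejected E (M i) (C i) (before i)) in *.
(* X i is what is offered to M i; Y X i is what M i leaves on offer to the elements. *)
set (Y := fun (X : K * E -> Prop) i x =>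
  (P i x \/ C i x) /\ ~ (X (i, x) /\ rej i (fun y => X (i, y)) x)).
(* The new [X] omits the pairs of [Y] that an element gives up for its index in [P]. More offers
   mean more rejections, so a smaller [Y], so fewer pairs given up: the map is monotone. *)
destruct (knaster_tarski (K * E) (fun X t => let (i, x) := t in
    (P i x \/ C i x) /\ ~ (Y X i x /\ exists j, j <> i /\ Y X j x /\ P j x))) as [X HX].
{ intros X1 X2 Hle.
  assert (HY : forall i x, Y X2 i x -> Y X1 i x).
  { intros i x [HF Hn]. split; [exact HF|]. intros [X1x [nC [J [HJ HJ']]]].
    apply Hn. split; [auto|]. split; [exact nC|]. exists J. split; [|exact HJ'].
    intros y Jy. destruct (HJ y Jy); auto. }
  intros [i x] [HF Hn]. split; [exact HF|]. intros [Yi [j [nji [Yj Pj]]]].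
  apply Hn. split; [auto|]. exists j; auto. }
assert (HPX : forall i x, P i x -> X (i, x)).
{ intros i x Px. apply HX. split; [auto|]. intros [_ [j [nji [_ Pj]]]].
  apply nji. apply (Hpack j i x); auto. }
(* At the fixed point, [S] is the intersection of [X] and [Y X]. *)
set (S := fun i => accepted E (M i) (C i) (before i) (fun x => X (i, x))).
assert (HSY : forall i x, S i x -> Y X i x).
{ intros i x [Xx Hn]. split; [exact (proj1 (proj1 (HX (i, x)) Xx))|]. intros [_ H]; auto. }
assert (HYS : forall i x, X (i, x) -> Y X i x -> S i x).
{ intros i x Xx [_ Hn]. split; [exact Xx|]. intros H. apply Hn; auto. }
(* With [x] kept at its packing index [i], any other pair of [x] in [Y X] is withdrawn from [X]. *)
assert (Hclash : forall i j x, P i x -> S i x -> S j x -> i = j).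
{ intros i j x Pi Si Sj. apply NNPP. intros n.
  apply (proj2 (proj1 (HX (j, x)) (proj1 Sj))). split; [auto|]. exists i; auto. }
exists S. split; [|split].
- intros i. destruct (Hbefore i (fun x => X (i, x))) as [IS Hspan]. fold (S i) in IS, Hspan.
  apply NNPP. intros nS.
  destruct (proj1 (proj2 (proj2 (HM i))) (S i) (P i) IS nS (HP i)) as [x [Px [nSx ISx]]].
  destruct (Hspan x (HPX i x Px)); auto.
- intros x.
  assert (HY : Y X (c x) x).
  { split; [right; reflexivity|]. intros [_ [nC _]]. apply nC. reflexivity. }
  (* If [(c x, x)] is withdrawn, it is in favour of a packing index [j] of [x]; the pair [(j, x)]
     lies in [X] by [HPX], hence in [S]. *)
  destruct (classic (X (c x, x))) as [Xx|nX]; [eauto|].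
  apply NNPP. intros Hn. apply nX. apply HX. split; [right; reflexivity|].
  intros [_ [j [_ [Yj Pj]]]]. apply Hn. exists j. auto.
- intros i j x Si Sj.
  destruct (proj1 (HSY i x Si)) as [Pi|Ci]; [eauto|].
  destruct (proj1 (HSY j x Sj)) as [Pj|Cj]; [symmetry; eauto|].
  unfold C in Ci, Cj. congruence.
Qed.
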